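(* Let $d\ge 1$ be a natural number. There are constants $C_d,c_d>0$ such that for all integers $n\ge 2$ and $q\ge 1$, in the Waiter-Client game on the edges of $K_n$ with bias $q$: (i) if $q\ge C_d n^{1+\frac1d}$, then Client has a strategy which ensures that at the end of the game all vertices of his graph have degree at most $d-1$; (ii) if $q\le c_d n^{1+\frac1d}$, then Waiter has a strategy which forces Client's graph at the end of the game to have a vertex of degree at least $d$.
   Context: The Waiter-Client game on the edges of $K_n$ with bias $q$ is a two-player perfect information game. In each round Waiter offers Client $q+1$ edges of $K_n$ that have not been previously offered; Client claims one of them and Waiter claims the remaining $q$. When fewer than $q+1$ not previously offered edges remain, Waiter claims all of them and the game ends. Client's graph is the graph on $V(K_n)$ formed by the edges claimed by Client. *)

(* Defs.v *)
From HB Require Import structures.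
From mathcomp Require Import all_boot all_order all_algebra.

Set Implicit Arguments.
Unset Strict Implicit.
Unset Printing Implicit Defensive.

Section WaiterClientGame.
Variables (T : finType) (board : {set T}) (q : nat).

(** A round is recorded as the set offered by Waiter together with the element
    of it claimed by Client; the other offered elements go to Waiter. *)
Definition round : Type := ({set T} * T)%type.

(** Rounds are listed in chronological order. *)
Definition history : Type := seq round.

Definition offered (h : history) : {set T} := \bigcup_(r <- h) r.1.

Definition unoffered (h : history) : {set T} := board :\: offered h.

Definition client_claims (h : history) : {set T} := [set x in map snd h].

Definition legal_offer (h : history) (A : {set T}) : Prop :=
  A \subset unoffered h /\ #|A| = q.+1.

Inductive legal_history : history -> Prop :=
| legal_start : legal_history [::]
| legal_round h A x :
    legal_history h -> legal_offer h A -> x \in A ->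
    legal_history (rcons h (A, x)).

(** Once fewer than [q + 1] unoffered elements remain, Waiter claims all of
    them; this does not change Client's claims, so it is not recorded. *)
Definition game_over (h : history) : Prop := #|unoffered h| < q.+1.

Definition client_strategy : Type := history -> {set T} -> T.

Definition legal_client_strategy (s : client_strategy) : Prop :=
  forall h A, legal_history h -> legal_offer h A -> s h A \in A.

Definition follows_client (s : client_strategy) (h : history) : Prop :=
  forall h1 A x h2, h = h1 ++ (A, x) :: h2 -> x = s h1 A.

Definition waiter_strategy : Type := history -> {set T}.

Definition legal_waiter_strategy (s : waiter_strategy) : Prop :=
  forall h, legal_history h -> ~ game_over h -> legal_offer h (s h).

Definition follows_waiter (s : waiter_strategy) (h : history) : Prop :=
  forall h1 A x h2, h = h1 ++ (A, x) :: h2 -> A = s h1.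

(** [P] is a property of the set of elements claimed by Client at the end of
    the game. *)
Definition client_can_ensure (P : {set T} -> Prop) : Prop :=
  exists s : client_strategy, legal_client_strategy s /\
    forall h, legal_history h -> game_over h -> follows_client s h ->
      P (client_claims h).

Definition waiter_can_force (P : {set T} -> Prop) : Prop :=
  exists s : waiter_strategy, legal_waiter_strategy s /\
    forall h, legal_history h -> game_over h -> follows_waiter s h ->
      P (client_claims h).

End WaiterClientGame.

(** An edge of a simple graph on ['I_n] is a two-element set of vertices, and a
    graph is represented by its set of edges. *)
Definition complete_graph (n : nat) : {set {set 'I_n}} :=
  [set e : {set 'I_n} | #|e| == 2].

Definition degree (n : nat) (G : {set {set 'I_n}}) (v : 'I_n) : nat :=
  #|[set e in G | v \in e]|.

(* Main.v *)
(** (i) Playing at random, Client would claim a fixed set of [d] edges with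
    probability at most [(q + 1)^-d], and there are at most [n^(d + 1)] stars
    with [d] edges; the method of conditional expectations turns this into a
    strategy.

    (ii) Waiter reserves disjoint blocks [A], [B_0], ..., [B_{d-1}] of about
    [n / (d + 1)] vertices. If [g] vertices of [A] of degree at least [i] still
    have all their edges to [B_i] unoffered, where [g] is about [q (d + 1) / n],
    offering [q + 1] of these edges forces one of the [g] vertices to have
    degree at least [i + 1]. So [g^d] vertices of [A] yield [g^(d-1)] vertices
    of degree at least 1, then [g^(d-2)] of degree at least 2, and finally one
    vertex of degree at least [d]; and [g^d <= #|A|] since
    [q <= c n^(1 + 1/d)]. *)

Require Import Defs.
From mathcomp Require Import all_boot all_order all_algebra.
From mathcomp Require Import zify.
From mathcomp Require Import boolp reals exp.

Set Implicit Arguments.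
Unset Strict Implicit.
Unset Printing Implicit Defensive.

Import Order.TTheory GRing.Theory Num.Theory.

(** * Subsets of prescribed size and a bound on binomial coefficients *)

Lemma subset_of_card (T : finType) (A : {set T}) (k : nat) :
  k <= #|A| -> exists2 B : {set T}, B \subset A & #|B| = k.
Proof.
move=> /card_geqP[s [s_uniq s_size sA]]; exists [set x in s].
  by apply/subsetP => x; rewrite inE => /sA.
by rewrite cardsE -s_size; apply/card_uniqP.
Qed.

Lemma bin_le_exp (m k : nat) : 'C(m, k) <= m ^ k.
Proof.
have le_ffact : m ^_ k <= m ^ k.
  elim: k => // k IHk; rewrite ffactnSr expnSr.
  by apply: leq_mul => //; apply: leq_subr.
by apply: leq_trans le_ffact; rewrite -bin_ffact leq_pmulr ?fact_gt0.
Qed.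

(** * Offers and claims along a history *)

Section Histories.
Variables (T : finType) (board : {set T}) (q : nat).
Implicit Types (h : history T) (A : {set T}) (x : T).

Lemma offered_rcons h A x : offered (rcons h (A, x)) = offered h :|: A.
Proof. by rewrite /offered big_rcons. Qed.

Lemma unoffered_rcons h A x :
  unoffered board (rcons h (A, x)) = unoffered board h :\: A.
Proof. by rewrite /unoffered offered_rcons setDDl. Qed.

Lemma client_claims_rcons h A x :
  client_claims (rcons h (A, x)) = x |: client_claims h.
Proof. by apply/setP => y; rewrite !inE map_rcons mem_rcons inE. Qed.

Lemma client_claims_offered h :
  legal_history board q h -> client_claims h \subset offered h.
Proof.
elim=> [|h' A x _ IHh _ xA]; first by apply/subsetP => x; rewrite inE.
by rewrite client_claims_rcons offered_rcons setUC setUSS ?sub1set.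
Qed.

Lemma client_claims_board h :
  legal_history board q h -> client_claims h \subset board.
Proof.
elim=> [|h' A x _ IHh [Aun _] xA]; first by apply/subsetP => x; rewrite inE.
rewrite client_claims_rcons subUset IHh andbT sub1set.
by have := subsetP Aun _ xA; rewrite inE => /andP[].
Qed.

Lemma follows_client_rcons s h A x :
  follows_client s (rcons h (A, x)) -> follows_client s h /\ x = s h A.
Proof.
move=> fol; split; last by apply: (fol h A x [::]); rewrite cats1.
move=> h1 A' x' h2 eq_h; apply: (fol h1 A' x' (rcons h2 (A, x))).
by rewrite eq_h rcons_cat.
Qed.

Lemma follows_waiter_rcons s h A x :
  follows_waiter s (rcons h (A, x)) -> follows_waiter s h /\ A = s h.
Proof.
move=> fol; split; last by apply: (fol h A x [::]); rewrite cats1.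
move=> h1 A' x' h2 eq_h; apply: (fol h1 A' x' (rcons h2 (A, x))).
by rewrite eq_h rcons_cat.
Qed.

End Histories.

(** * Client's side: the method of conditional expectations *)

Section ClientPotential.
Variables (T : finType) (board : {set T}) (q : nat) (F : {set {set T}}).
Implicit Types (h : history T) (A S : {set T}) (x : T).

(** When all members of [F] have size [k], dividing by [q.+1 ^ k] gives an upper
    bound on the expected number of members of [F] that Client claims completely
    if he plays at random from now on. It need not be exact since two elements
    of a member may be offered in the same round. *)
Definition potential h : nat :=
  \sum_(S in F | S :&: offered h \subset client_claims h)
     q.+1 ^ #|S :&: client_claims h|.

(** Exchanging the sums, it suffices to treat each [S] alone. If [S] has already lost an element to
    Waiter, it never contributes again. If [S] misses [A], each of the [q.+1] choices leaves its
    weight unchanged. If [S] contains some [y] of [A], only the choice of [y] can keep it alive, and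
    this multiplies its weight by at most [q.+1]. *)
Lemma sum_potential_rcons h A :
  legal_history board q h -> legal_offer board q h A ->
  \sum_(x in A) potential (rcons h (A, x)) <= q.+1 * potential h.
Proof.
move=> legh [Aun cardA]; have cl_off := client_claims_offered legh.
have A_fresh x : x \in A -> x \notin offered h.
  by move=> /(subsetP Aun); rewrite inE => /andP[].
rewrite /potential big_distrr /= [leqRHS]big_mkcondr /=.
under eq_bigr do rewrite big_mkcondr /=.
rewrite exchange_big /=; apply: leq_sum => S _.
case: ifPn => [alive|/subsetPn[e]]; last first.
  rewrite inE => /andP[eS eoff] ecl; rewrite big1 // => x xA.
  rewrite offered_rcons client_claims_rcons ifF //; apply/negbTE/subsetPn.
  exists e; first by rewrite !inE eS eoff.
  rewrite !inE negb_or; apply/andP; split; last by rewrite inE in ecl.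
  by apply: contraTneq eoff => ->; apply: A_fresh.
have [SA0|[y]] := set_0Vmem (S :&: A).
  rewrite -cardA -sum_nat_const; apply: leq_sum => x xA.
  case: ifP => // _; rewrite client_claims_rcons setIUr.
  suff -> : S :&: [set x] = set0 by rewrite set0U.
  apply/setP => z; rewrite !inE; apply/negbTE/negP => /andP[zS /eqP zx].
  by have := in_set0 x; rewrite -SA0 inE -zx zS zx xA.
rewrite inE => /andP[yS yA].
rewrite (bigD1 y) //= big1 ?addn0 => [|x]; last first.
  move=> /andP[xA xy]; rewrite ifF // offered_rcons client_claims_rcons.
  apply/negbTE/subsetPn; exists y; first by rewrite !inE yS yA orbT.
  rewrite in_setU1 negb_or eq_sym xy /=.
  by apply: contra (A_fresh _ yA) => /(subsetP cl_off).
case: ifP => // _; rewrite -expnS leq_pexp2l // client_claims_rcons setIUr.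
apply: leq_trans (leq_card_setU _ _) _.
by rewrite -add1n leq_add2r -(cards1 y) subset_leq_card // subsetIr.
Qed.

(** Always choosing an element that minimizes the potential keeps it from
    growing, and a completely claimed [S] alone contributes [q.+1 ^ k]. *)
Lemma client_avoids (x0 : T) (k : nat) :
  {in F, forall S, #|S| = k} -> #|F| < q.+1 ^ k ->
  client_can_ensure board q (fun G => {in F, forall S, ~~ (S \subset G)}).
Proof.
move=> F_card F_small.
(* The default [x0] is reached only for an empty [A], which is never a legal offer. *)
pose s h A :=
  [arg min_(x < odflt x0 [pick x in A] in A) potential (rcons h (A, x))].
have s_min h A x : x \in A ->
    s h A \in A /\ potential (rcons h (A, s h A)) <= potential (rcons h (A, x)).
  move=> xA; rewrite /s; case: pickP => [y yA|/(_ x)]; last by rewrite xA.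
  by case: arg_minnP => //= z zA zmin; split=> //; apply: zmin.
exists s; split=> [h A _ [_ cardA]|h legh _ fol].
  have /card_gt0P[x xA] : 0 < #|A| by rewrite cardA.
  by case: (s_min h A x xA).
have pot_small : potential h < q.+1 ^ k.
  elim: legh fol => [|h' A x legh' IHh offA xA] fol.
    apply: leq_ltn_trans F_small; rewrite /potential -sum1_card big_mkcondr.
    apply: leq_sum => S _; case: ifP => // _.
    suff -> : client_claims ([::] : history T) = set0 by rewrite setI0 cards0.
    by apply/setP => x; rewrite !inE.
  have [fol' eq_x] := follows_client_rcons fol.
  apply: leq_ltn_trans (IHh fol').
  (* The least of the [q.+1] possible new potentials is at most their average. *)
  rewrite -(leq_pmul2l (ltn0Sn q)).
  apply: leq_trans (sum_potential_rcons legh' offA).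
  case: offA => _ <-; rewrite -sum_nat_const; apply: leq_sum => y yA.
  by rewrite eq_x; case: (s_min h' A y yA).
move=> S SF; apply: contraL pot_small => Scl; rewrite -leqNgt /potential.
rewrite (bigD1 S) /=; last by rewrite SF (subset_trans _ Scl) ?subsetIl.
by rewrite (setIidPl Scl) F_card // leq_addr.
Qed.

End ClientPotential.

(** * Winning positions of Waiter *)

Section WaiterWins.
Variables (T : finType) (board : {set T}) (q : nat) (P : {set T} -> Prop).

(** A well-founded tree of offers. A leaf asks for [P] at the current claims, possibly before the
    game is over. *)
Inductive waiter_wins : history T -> Prop :=
| waiter_wins_now h : P (client_claims h) -> waiter_wins h
| waiter_wins_offer h A : legal_offer board q h A ->
    (forall x, x \in A -> waiter_wins (rcons h (A, x))) -> waiter_wins h.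

(** Waiter makes a winning offer whenever there is one, and any legal offer otherwise. Play then
    stays among winning positions, since [P] persists by monotonicity once it is reached. At the end
    no legal offer is left, so the position can only be a leaf. *)
Lemma waiter_wins_can_force :
  (forall G G' : {set T}, G \subset G' -> P G -> P G') ->
  waiter_wins [::] -> waiter_can_force board q P.
Proof.
move=> P_mono win0.
pose good h (A : {set T}) := legal_offer board q h A /\
  forall x, x \in A -> waiter_wins (rcons h (A, x)).
pose s h := if [pick A | `[<good h A>]] is Some A then A else
  odflt set0 [pick A | `[<legal_offer board q h A>]].
have s_good h A : good h A -> good h (s h).
  by move=> goodA; rewrite /s; case: pickP => [B /asboolP|/(_ A) /asboolP].
exists s; split=> [h legh|h legh over fol].
  move=> /negP; rewrite -leqNgt => /subset_of_card[A Aun cardA].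
  rewrite /s; case: pickP => [B /asboolP[] //|_].
  by case: pickP => [B /asboolP //|/(_ A) /asboolP []].
have: waiter_wins h.
  elim: legh fol {over} => // h' A x _ IHh _ xA fol.
  have [fol' eqA] := follows_waiter_rcons fol.
  case: (IHh fol') eqA xA => [h1 Ph1 _ _|h1 A1 leg1 win1 eqA xA].
    apply: waiter_wins_now; apply: P_mono Ph1.
    by rewrite client_claims_rcons subsetUr.
  by rewrite eqA in xA *; case: (s_good h1 A1 (conj leg1 win1)) => _; apply.
move=> win; case: win over => // h1 A [Aun cardA] _ over.
by have := leq_ltn_trans (subset_leq_card Aun) over; rewrite cardA ltnn.
Qed.

End WaiterWins.

(** * Edges between two vertex sets, and degrees *)

Section Cuts.
Variable V : finType.
Implicit Types (X Y : {set V}) (u v : V).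

Definition cut X Y : {set {set V}} := [set [set p.1; p.2] | p in setX X Y].

Lemma cutP X Y (e : {set V}) :
  reflect (exists v u, [/\ v \in X, u \in Y & e = [set v; u]]) (e \in cut X Y).
Proof.
apply: (iffP imsetP) => [[[v u]]|[v [u [vX uY ->]]]].
  by rewrite inE => /andP[vX uY] ->; exists v, u.
by exists (v, u); rewrite // inE vX uY.
Qed.

(** The two inequalities exclude the crossed match of endpoints; they hold for edges between
    disjoint sides. *)
Lemma set2_inj u v u' v' :
  v != u' -> v' != u -> [set v; u] = [set v'; u'] -> v = v' /\ u = u'.
Proof.
move=> vu' v'u eq_e.
have := set21 v u; rewrite eq_e !inE (negbTE vu') orbF => /eqP vv'.
have := set22 v u; rewrite eq_e !inE eq_sym (negbTE v'u) => /eqP uu'.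
by [].
Qed.

Lemma disjoint_neq X Y u v : [disjoint X & Y] -> v \in X -> u \in Y -> v != u.
Proof. by move=> dis vX; apply: contraTneq => <-; rewrite (disjointFr dis). Qed.

Lemma card_cut_edge X Y (e : {set V}) :
  [disjoint X & Y] -> e \in cut X Y -> #|e| = 2.
Proof.
move=> dis /cutP[v [u [vX uY ->]]].
by rewrite cards2 (disjoint_neq dis).
Qed.

Lemma card_cut X Y : [disjoint X & Y] -> #|cut X Y| = #|X| * #|Y|.
Proof.
move=> dis; rewrite card_in_imset ?cardsX // => -[v u] [v' u'].
rewrite !inE /= => /andP[vX uY] /andP[v'X u'Y] eq_e.
by have [-> ->] :=
  set2_inj (disjoint_neq dis vX u'Y) (disjoint_neq dis v'X uY) eq_e.
Qed.

Lemma cutS X X' Y : X \subset X' -> cut X Y \subset cut X' Y.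
Proof.
move=> /subsetP sub; apply/imsetS/subsetP => p.
by rewrite !inE => /andP[/sub-> ->].
Qed.

Lemma cutUl X X' Y : cut (X :|: X') Y = cut X Y :|: cut X' Y.
Proof.
rewrite /cut -imsetU; congr [set [set p.1; p.2] | p in pred_of_set _].
by apply/setP => -[v u]; rewrite !inE andb_orl.
Qed.

Lemma disjoint_cut X X' Y Y' :
  [disjoint X & Y'] -> [disjoint X' & Y] ->
  [disjoint X & X'] || [disjoint Y & Y'] -> [disjoint cut X Y & cut X' Y'].
Proof.
move=> XY' X'Y dis; apply/pred0P => e /=; apply/negbTE/negP.
move=> /andP[/cutP[v [u [vX uY ->]]] /cutP[v' [u' [v'X' u'Y' eq_e]]]].
have [vv' uu'] :=
  set2_inj (disjoint_neq XY' vX u'Y') (disjoint_neq X'Y v'X' uY) eq_e.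
case/orP: dis => dis.
  by have := disjoint_neq dis vX v'X'; rewrite vv' eqxx.
by have := disjoint_neq dis uY u'Y'; rewrite uu' eqxx.
Qed.

End Cuts.

Section Degrees.
Variable n : nat.
Implicit Types (G : {set {set 'I_n}}) (v : 'I_n).

Lemma degreeS G G' v : G \subset G' -> degree G v <= degree G' v.
Proof.
move=> /subsetP sub; apply/subset_leq_card/subsetP => e.
by rewrite !inE => /andP[/sub-> ->].
Qed.

Lemma degreeU1 G (e : {set 'I_n}) v :
  e \notin G -> v \in e -> degree (e |: G) v = (degree G v).+1.
Proof.
move=> eG ve; rewrite /degree.
have -> : [set f in e |: G | v \in f] = e |: [set f in G | v \in f].
  by apply/setP => f; rewrite !inE andb_orl; case: eqP => // ->; rewrite ve.
by rewrite cardsU1 inE (negbTE eG).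
Qed.

End Degrees.

(** * Waiter's side: raising degrees level by level *)

Section WaiterLevels.
Variables (n q d g : nat) (A : {set 'I_n}) (B : nat -> {set 'I_n}).
Hypothesis disAB : forall i, [disjoint A & B i].
Hypothesis disBB : forall i j, i != j -> [disjoint B i & B j].
Hypothesis gB : forall i, i < d -> q < g * #|B i|.

Let wins := waiter_wins (complete_graph n) q
  (fun G => exists v : 'I_n, d <= degree G v).

(** Induction on [k], the number of levels left: each group of [g] vertices at level [i] yields one
    vertex at level [i.+1], so [g ^ k.+1] vertices yield [g ^ k]. Only the edges to blocks of index
    at least [i] have to be unoffered, so level [i] may use up those to [B i]. *)
Lemma waiter_wins_level k i (S : {set 'I_n}) (h : history {set 'I_n}) :
  i + k = d -> client_claims h \subset offered h ->
  S \subset A -> #|S| = g ^ k ->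
  {in S, forall v, i <= degree (client_claims h) v} ->
  (forall j, i <= j < d ->
     cut S (B j) \subset unoffered (complete_graph n) h) ->
  wins h.
Proof.
elim: k i S h => [|k IHk] i S h ikd cl_off SA cardS degS freshS.
  have /eqP/cards1P[v Sv] := cardS.
  apply: waiter_wins_now; exists v; rewrite -ikd addn0.
  by apply: degS; rewrite Sv set11.
have lt_id : i < d by lia.
(* [S] splits into [m] groups still to be offered to [B i]; [S'] collects the
   vertices picked from the earlier groups. *)
suff promote m : forall (S S' : {set 'I_n}) h,
    client_claims h \subset offered h -> S \subset A -> S' \subset A ->
    [disjoint S & S'] -> #|S| = m * g -> #|S'| + m = g ^ k ->
    {in S, forall v, i <= degree (client_claims h) v} ->
    {in S', forall v, i < degree (client_claims h) v} ->
    (forall j, i <= j < d ->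
       cut S (B j) \subset unoffered (complete_graph n) h) ->
    (forall j, i < j < d ->
       cut S' (B j) \subset unoffered (complete_graph n) h) ->
    wins h.
  apply: (promote (g ^ k) S set0 h) => //.
  - exact: sub0set.
  - by rewrite -setI_eq0 setI0 eqxx.
  - by rewrite cardS expnSr.
  - by rewrite cards0.
  - by move=> v; rewrite inE.
  - by move=> j _; apply/subsetP => e /cutP[v [u []]]; rewrite inE.
elim: m => [|m IHm] {cl_off SA cardS degS freshS S h} S S' h
  cl_off SA S'A SS' cardS cardS' degS degS' freshS freshS'.
  (* No group is left: [S'] has [g ^ k] vertices, ready for level [i.+1]. *)
  by apply: (IHk i.+1 S') => //; rewrite ?addSnnS //; lia.
have [X XS cardX] : exists2 X : {set 'I_n}, X \subset S & #|X| = g.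
  by apply: subset_of_card; rewrite cardS mulSn leq_addr.
have XA := subset_trans XS SA.
have disXB j : [disjoint X & B j] by apply: disjointWl XA (disAB j).
(* By [gB] the group [X] sends more than [q] edges to [B i], enough for one offer. *)
have [Y YX cardY] : exists2 Y : {set {set 'I_n}},
    Y \subset cut X (B i) & #|Y| = q.+1.
  by apply: subset_of_card; rewrite card_cut // cardX gB.
have Yun : Y \subset unoffered (complete_graph n) h.
  apply: subset_trans YX (subset_trans (cutS _ XS) _).
  by apply: freshS; rewrite leqnn.
refine (@waiter_wins_offer _ _ _ _ h Y (conj Yun cardY) _) => e eY.
have /cutP[v [u [vX uB eq_e]]] := subsetP YX _ eY.
have vS := subsetP XS _ vX.
(* Since [e] is a new edge at [v], claiming it raises the degree of [v], which can then join
   [S']. *)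
have e_new : e \notin client_claims h.
  have := subsetP Yun _ eY; rewrite inE => /andP[eoff _].
  by apply: contra eoff => /(subsetP cl_off).
(* The offer spoils no edge reserved for later: such an edge either starts outside [X] (later
   groups) or ends in another block (promoted vertices). *)
have disY (Z : {set 'I_n}) j : Z \subset A ->
    [disjoint Z & X] || (j != i) -> [disjoint cut Z (B j) & Y].
  move=> ZA dis; rewrite disjoint_sym; apply: disjointWl YX _.
  apply: disjoint_cut => //; first exact: disjointWl ZA (disAB i).
  rewrite disjoint_sym; case/orP: dis => [->//|ji].
  by rewrite disBB ?orbT // eq_sym.
have S'v : v \notin S' by rewrite (disjointFr SS' vS).
apply: (IHm (S :\: X) (v |: S')).
- by rewrite client_claims_rcons offered_rcons setUC setUSS ?sub1set.
- exact: subset_trans (subsetDl _ _) SA.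
- by rewrite subUset sub1set S'A (subsetP SA).
- apply/pred0P => w /=; rewrite !inE; case: eqP => [->|_]; first by rewrite vX.
  by case wS: (w \in S); rewrite ?andbF //= (disjointFr SS' wS) andbF.
- by rewrite cardsD (setIidPr XS) cardS cardX mulSn addKn.
- by rewrite cardsU1 S'v add1n addSnnS.
- move=> w; rewrite inE => /andP[_ /degS wS]; apply: leq_trans wS _.
  by apply: degreeS; rewrite client_claims_rcons subsetUr.
- move=> w; rewrite client_claims_rcons !inE => /orP[/eqP ->|wS'].
    by rewrite degreeU1 // ?ltnS ?degS // eq_e set21.
  by apply: leq_trans (degS' _ wS') _; apply/degreeS/subsetUr.
- move=> j ijd; rewrite unoffered_rcons subsetD; apply/andP; split.
    by rewrite (subset_trans (cutS _ (subsetDl S X))) // freshS.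
  apply: disY; first exact: subset_trans (subsetDl _ _) SA.
  by rewrite -setI_eq0 setIDAC setDIl setDv setI0 eqxx.
- move=> j /andP[ij jd]; rewrite unoffered_rcons subsetD; apply/andP; split.
    rewrite cutUl subUset freshS' ?ij // andbT.
    by rewrite (subset_trans _ (freshS j _)) ?cutS ?sub1set // (ltnW ij).
  apply: disY; first by rewrite subUset sub1set S'A (subsetP SA).
  by rewrite gtn_eqF ?orbT.
Qed.

End WaiterLevels.

(** * Sizes of the vertex blocks *)

Lemma card_block (n b i : nat) : i.+1 * b <= n ->
  b <= #|[set v : 'I_n | v %/ b == i]|.
Proof.
(* The block contains all vertices [i * b + k] with [k < b]. *)
move=> ib_le; have lt_n (k : 'I_b) : i * b + k < n.
  by apply: leq_trans ib_le; rewrite mulSn addnC ltn_add2r.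
rewrite -{1}(card_ord b) -(card_imset predT (f := fun k => Ordinal (lt_n k))).
  apply/subset_leq_card/subsetP => _ /imsetP[k _ ->]; rewrite inE /=.
  have b_gt0 : 0 < b by apply: leq_ltn_trans (ltn_ord k).
  by rewrite divnMDl // divn_small ?addn0.
by move=> k l /(congr1 val) /= /addnI /val_inj.
Qed.

(** Write [g] for [(q %/ b).+1] and [D] for [d.+1.*2]. When [b <= q], both [g * b <= 2 * q] and
    [n <= D * b] hold, so the hypothesis gives [(D ^ 2 * (g * b)) ^ d <= (D * b) ^ d.+1]. Cancelling
    [D ^ d.+1] and then [b ^ d] leaves the claim. *)
Lemma block_size_bound (n q d : nat) (b := n %/ d.+1) : 0 < d -> 0 < q ->
  (2 * d.+1.*2 ^ 2 * q) ^ d <= n ^ d.+1 ->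
  0 < b /\ (q %/ b).+1 ^ d <= b.
Proof.
move=> d_gt0 q_gt0 q_small; set D := d.+1.*2 in q_small *.
(* From [D ^ (2 * d) <= n ^ d.+1 <= n ^ (2 * d)]; this makes [b] positive. *)
have D_le_n : D <= n.
  rewrite -(leq_exp2r _ _ (isT : 0 < 2)).
  have : (D ^ 2) ^ d <= (n ^ 2) ^ d.
    apply: leq_trans (leq_trans q_small _).
      by rewrite leq_exp2r // mulnAC leq_pmull ?muln_gt0.
    rewrite -expnM; case: (posnP n) => [->|n_gt0].
      by rewrite !exp0n // muln_gt0.
    by rewrite leq_pexp2l //; lia.
  by rewrite leq_exp2r.
have b_gt0 : 0 < b.
  by rewrite divn_gt0 //; apply: leq_trans D_le_n; rewrite /D; lia.
split=> //.
have [q_lt|b_le_q] := ltnP q b; first by rewrite divn_small // exp1n.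
have gb : (q %/ b).+1 * b <= 2 * q.
  by rewrite mulSn mul2n -addnn leq_add // leq_trunc_div.
have n_le : n <= D * b.
  by have := ltn_ceil n (ltn0Sn d); rewrite -/b /D; nia.
have D_gt0 : 0 < D by [].
have key : (D ^ 2 * ((q %/ b).+1 * b)) ^ d <= (D * b) ^ d.+1.
  apply: leq_trans (leq_trans q_small _); last by rewrite leq_exp2r.
  by rewrite leq_exp2r // (mulnC 2) -mulnA leq_mul.
(* The square on [D] pays for the cancellation: [d.+1 <= 2 * d] as [d] is positive. *)
have b_exp : ((q %/ b).+1 * b) ^ d <= b ^ d.+1.
  rewrite -(leq_pmul2l (_ : 0 < D ^ d.+1)) ?expn_gt0 ?D_gt0 // -expnMn.
  apply: leq_trans key; rewrite [leqRHS]expnMn leq_mul2r -expnM.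
  by rewrite leq_pexp2l ?orbT //; lia.
by rewrite -(leq_pmul2r (_ : 0 < b ^ d)) ?expn_gt0 ?b_gt0 // -expnMn -expnS.
Qed.

(** * Both halves of the theorem with integer thresholds *)

(** Client avoids the family [F] of all stars with [d] edges. It has at most [n * 'C(n, d)] members,
    hence at most [n ^ d.+1]. *)
Lemma client_bounds_degree (n q d : nat) : 0 < n -> n ^ d.+1 < q.+1 ^ d ->
  client_can_ensure (complete_graph n) q
    (fun G => forall v : 'I_n, degree G v < d).
Proof.
move=> n_gt0 n_small.
pose star (v : 'I_n) := [set e in complete_graph n | v \in e].
pose F := \bigcup_v [set S : {set {set 'I_n}} | S \subset star v & #|S| == d].
have card_star v : #|star v| <= n.
  rewrite -[leqRHS](card_ord n).
  apply: leq_trans (leq_imset_card (fun u => [set v; u]) predT).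
  apply/subset_leq_card/subsetP => e.
  rewrite !inE => /andP[/cards2P[x [y [_ ->]]]].
  rewrite !inE => /orP[] /eqP ->; apply/imsetP; first by exists y.
  by exists x; rewrite // setUC.
have card_F : #|F| <= n ^ d.+1.
  apply: (@leq_trans (\sum_(v < n) n ^ d)); last first.
    by rewrite sum_nat_const card_ord expnS.
  apply: (@leq_trans (\sum_v 'C(#|star v|, d))); last first.
    apply: leq_sum => v _; apply: leq_trans (bin_le_exp _ _) _.
    by case: (d) => // k; rewrite leq_exp2r.
  rewrite /F; elim/big_rec2: _ => [|v m X _ IH]; first by rewrite cards0.
  by apply: leq_trans (leq_card_setU _ _) _; rewrite cards_draws leq_add2l.
have F_card : {in F, forall S : {set {set 'I_n}}, #|S| = d}.
  by move=> S /bigcupP[v _]; rewrite inE => /andP[_ /eqP].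
(* Here [set0] is merely the default element for Client's strategy. *)
have [s [s_legal s_avoids]] :=
  client_avoids (complete_graph n) (set0 : {set 'I_n}) F_card
    (leq_ltn_trans card_F n_small).
exists s; split=> // h legh over fol v; rewrite ltnNge; apply/negP.
move=> /subset_of_card[S Ssub cardS].
have SF : S \in F.
  apply/bigcupP; exists v => //; rewrite inE cardS eqxx andbT.
  apply: subset_trans Ssub _; apply/subsetP => e; rewrite !inE => /andP[eG ->].
  by have := subsetP (client_claims_board legh) e; rewrite !inE => ->.
have /negP := s_avoids h legh over fol S SF; apply.
by apply: subset_trans Ssub _; apply/subsetP => e; rewrite inE => /andP[].
Qed.

Lemma waiter_forces_degree (n q d : nat) : 0 < d -> 0 < q ->
  (2 * d.+1.*2 ^ 2 * q) ^ d <= n ^ d.+1 ->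
  waiter_can_force (complete_graph n) q
    (fun G => exists v : 'I_n, d <= degree G v).
Proof.
move=> d_gt0 q_gt0 q_small.
have [b_gt0 g_small] := block_size_bound d_gt0 q_gt0 q_small.
(* This [g] is the least number with [q < g * b]. Block 0 plays the role of [A], and block [i.+1]
   that of [B i]. *)
set b := n %/ d.+1 in b_gt0 g_small; set g := (q %/ b).+1 in g_small.
pose block i := [set v : 'I_n | v %/ b == i].
have card_blk i : i <= d -> b <= #|block i|.
  move=> id; apply: card_block; apply: leq_trans (leq_trunc_div n d.+1).
  by rewrite mulnC leq_mul2l ltnS id orbT.
have dis_blk i j : i != j -> [disjoint block i & block j].
  move=> ij; apply/pred0P => v /=; rewrite !inE.
  by apply/negbTE/negP => /andP[/eqP -> /eqP ij']; rewrite ij' eqxx in ij.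
have [S SA cardS] := subset_of_card (leq_trans g_small (card_blk 0 isT)).
apply: waiter_wins_can_force => [G G' sub [v vd]|].
  by exists v; apply: leq_trans vd _; apply: degreeS.
have claims0 : client_claims ([::] : history {set 'I_n}) = set0.
  by apply/setP => e; rewrite !inE.
apply: (@waiter_wins_level n q d g (block 0) (fun i => block i.+1)
  _ _ _ d 0 S) => //.
- by move=> i; apply: dis_blk.
- by move=> i j ij; apply: dis_blk.
- move=> i id; apply: leq_trans (ltn_ceil q b_gt0) _.
  by rewrite leq_mul2l card_blk ?orbT.
- by rewrite claims0 sub0set.
- move=> j _; rewrite /unoffered /offered big_nil setD0.
  apply/subsetP => e eC; rewrite inE; apply/eqP; apply: card_cut_edge eC.
  exact: disjointWl SA (dis_blk 0 j.+1 isT).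
Qed.

(** * From real thresholds to integer inequalities *)

Local Open Scope ring_scope.

Lemma powR_exponent (R : realType) (d n : nat) : (0 < d)%N ->
  ((n%:R : R) `^ (1 + 1 / d%:R)) ^+ d = (n ^ d.+1)%:R.
Proof.
move=> d_gt0; have d_neq0 : d%:R != 0 :> R by rewrite pnatr_eq0 -lt0n.
rewrite -powR_mulrn ?powR_ge0 // -powRrM mulrDl !mul1r mulVf //.
by rewrite natr1 powR_mulrn ?natrX.
Qed.

Theorem theorem1p4 (R : realType) (d : nat) (hd : (1 <= d)%N) :
  exists C c : R, [/\ 0 < C, 0 < c &
    forall n q : nat, (2 <= n)%N -> (1 <= q)%N ->
      (C * n%:R `^ (1 + 1 / d%:R) <= q%:R ->
         client_can_ensure (complete_graph n) q
           (fun G => forall v : 'I_n, (degree G v <= d - 1)%N)) /\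
      (q%:R <= c * n%:R `^ (1 + 1 / d%:R) ->
         waiter_can_force (complete_graph n) q
           (fun G => exists v : 'I_n, (d <= degree G v)%N))].
Proof.
(* After taking [d]-th powers, [C = 1] suffices because [n ^ d.+1 <= q ^ d < q.+1 ^ d], and
   [c = 1 / K] turns the bound on [q] into [(K * q) ^ d <= n ^ d.+1]. *)
pose K := (2 * d.+1.*2 ^ 2)%N.
have K_gt0 : 0 < K%:R :> R by rewrite ltr0n muln_gt0 expn_gt0.
exists 1, K%:R^-1; split; rewrite ?invr_gt0 // => n q n_ge2 q_gt0.
have p_ge0 := powR_ge0 (n%:R : R) (1 + 1 / d%:R).
split=> [q_large|q_small].
  have n_small : (n ^ d.+1 < q.+1 ^ d)%N.
    apply: (@leq_ltn_trans (q ^ d)); last by rewrite ltn_exp2r.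
    rewrite -(ler_nat R) -(powR_exponent R n hd) natrX lerXn2r ?nnegrE //.
    by rewrite mul1r in q_large.
  have [s [s_legal s_small]] := client_bounds_degree (ltnW n_ge2) n_small.
  exists s; split=> // h legh over fol v.
  by rewrite subn1 -ltnS prednK // s_small.
apply: waiter_forces_degree => //.
rewrite -(ler_nat R) -(powR_exponent R n hd) natrX lerXn2r ?nnegrE //.
by rewrite natrM mulrC -ler_pdivlMr // mulrC.
Qed.
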